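(* Let $k\ge 3$ and let $f\in\mathbb{R}[x_1,\ldots,x_k]$. Assume that $f$ depends non-trivially on each of its variables and that $\mathrm{rank}(f)=1$. Then $f$ has one of the forms $$f(x_1,\ldots,x_k)=h\left(p_1(x_1)+\cdots+p_k(x_k)\right)\quad\text{or}\quad f(x_1,\ldots,x_k)=h\left(p_1(x_1)\cdot\ldots\cdot p_k(x_k)\right),$$ for some univariate real polynomials $h(x),p_1(x),\ldots,p_k(x)$.
   Context: Rank of a polynomial. Let $f\in\mathbb{R}[x_1,\ldots,x_k]$ and let $d_{x_1}$ be the degree of $f$ with respect to $x_1$. Write $f(x_1,\ldots,x_k)=\sum_{i=0}^{d_{x_1}}\alpha_i(x_2,\ldots,x_k)x_1^i$. The coefficient map $T=T_{f,x_1}:\mathbb{R}^{k-1}\to\mathbb{R}^{d_{x_1}+1}$ is $(x_2,\ldots,x_k)\mapsto(\alpha_0(x_2,\ldots,x_k),\ldots,\alpha_{d_{x_1}}(x_2,\ldots,x_k))$. Define $\mathrm{rank}_{x_1}(f):=\mathrm{rank}(J_T)$, where $J_T$ is the Jacobian matrix of $T$, viewed as a matrix with polynomial entries (its rank is taken over the field of rational functions $\mathbb{R}(x_2,\ldots,x_k)$, i.e. it is the generic rank). Define $\mathrm{rank}_{x_i}(f)$ for $i=2,\ldots,k$ similarly, with $x_i$ playing the role of $x_1$. Finally, $\mathrm{rank}(f):=\max_{1\le i\le k}\mathrm{rank}_{x_i}(f)$. That $f$ depends non-trivially on $x_i$ means $\partial f/\partial x_i\not\equiv 0$. *)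

(* Defs.v *)
From mathcomp Require Import all_boot all_order all_algebra.
From mathcomp Require Import fraction reals mpoly.

Set Implicit Arguments.
Unset Strict Implicit.
Unset Printing Implicit Defensive.

Import GRing.Theory.
Local Open Scope ring_scope.

Section PolynomialRank.
Context (R : realType) (k : nat).
Implicit Types (f : {mpoly R[k]}) (j : 'I_k).

Definition mdegv f j : nat := \max_(m <- msupp f) m j.

(* The coefficient of 'X_j ^+ i in f, as a polynomial in the remaining k.-1
   variables: variable number l : 'I_k.-1 stands for 'X_(lift j l). *)
Definition mcoefv f j (i : nat) : {mpoly R[k.-1]} :=
  \sum_(m <- msupp f | m j == i)
     f@_m *: 'X_[ [multinom m (lift j l) | l < k.-1] ].

Definition jacobianv f j : 'M[{mpoly R[k.-1]}]_((mdegv f j).+1, k.-1) :=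
  \matrix_(i, l) (mcoefv f j i)^`M(l).

Definition rankv f j : nat := \rank (map_mx (@tofrac _) (jacobianv f j)).

Definition mprank f : nat := \max_(j < k) rankv f j.

End PolynomialRank.

(* Main.v *)
(* If f has rank 1 then, for each variable x_j, the gradients of its
   coefficients with respect to x_j are parallel, so f_l / f_m does not involve
   x_j for j distinct from l and m.  With at least three variables, specializing
   at a generic point gives f_l / f_m = (a_l / b_l)(x_l) / (a_m / b_m)(x_m) with
   univariate coprime a_l, b_l.  The polynomials g satisfying the same relations
   form an algebra K on which D g := b_l g_l / a_l (independent of l) is again a
   polynomial, so D is a derivation of K.  It does not raise the degree in a
   chosen variable, and D g - deg(g) rho g has smaller degree than g for a
   constant rho that depends only on a and b.  Hence a nonconstant w in K of
   minimal degree satisfies D w = deg(w) rho w + mu with mu constant.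
   If rho = 0, each w_l depends on x_l only, so w is a sum of univariate
   polynomials, D lowers degrees, and integrating D g shows by induction that
   every g in K is a polynomial in w.
   If rho <> 0, then after adding a constant w is an eigenvector of D, hence a
   product of univariate polynomials; an element of K is the sum of a polynomial
   in w and an eigenvector F, whose d-th power is proportional to a power of w
   (d = deg w), so that w divides F and induction applies to F / w. *)
Require Import Defs.
From HB Require Import structures.
From mathcomp Require Import all_boot all_order all_algebra.
From mathcomp Require Import ring zify boolp.
From mathcomp Require Import fraction reals mpoly.

Set Implicit Arguments.
Unset Strict Implicit.
Unset Printing Implicit Defensive.

Import Order.TTheory GRing.Theory Num.Theory.
Local Open Scope ring_scope.

(** * Ring induction for multivariate polynomials *)

Lemma mpoly_ring_ind (n : nat) (R : nzRingType) (P : {mpoly R[n]} -> Prop) :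
  (forall c, P c%:MP) -> (forall i, P 'X_i) ->
  (forall p q, P p -> P q -> P (p + q)) ->
  (forall p q, P p -> P q -> P (p * q)) ->
  forall p, P p.
Proof.
move=> PC PX PD PM; apply: mpolyind => [|c m p _ _ Pp]; first by rewrite -mpolyC0.
apply: (PD) => //; rewrite -mul_mpolyC; apply: (PM) => //.
rewrite mpolyXE_id; apply: (big_ind P) => [|//|i _]; first by rewrite -mpolyC1.
by elim: (m i) => [|j IHj]; rewrite ?exprS; [rewrite expr0 -mpolyC1|apply: (PM)].
Qed.

Lemma mpoly_rmorph_ext (n : nat) (R S : nzRingType)
    (phi psi : {rmorphism {mpoly R[n]} -> S}) :
    (forall c, phi c%:MP = psi c%:MP) -> (forall i, phi 'X_i = psi 'X_i) ->
  phi =1 psi.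
Proof.
move=> eqC eqX; apply: mpoly_ring_ind => // p q IHp IHq.
  by rewrite !rmorphD IHp IHq.
by rewrite !rmorphM IHp IHq.
Qed.

Lemma natr_poly_neq0 (n : nat) (R : numFieldType) (d : nat) :
  ((d%:R : {mpoly R[n]}) == 0) = (d == 0)%N.
Proof. by rewrite -mpolyC_nat mpolyC_eq0 pnatr_eq0. Qed.

(** * Polynomials with vanishing Wronskians are proportional *)

Section Wronskian.
Variables (n : nat) (R : numFieldType).
Implicit Types f p q : {mpoly R[n]}.

(* The Euler operator ['X_l d/dX_l] is diagonal on monomials, so comparing the
   coefficients of the product of the leading monomials of [w - c P] and [P]
   forces these monomials to coincide. *)
Lemma wronskian_eq0 (w P : {mpoly R[n]}) : P != 0 ->
    (forall l, w^`M(l) * P = w * P^`M(l)) ->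
  exists c, w = c *: P.
Proof.
move=> P0 wP; exists (w@_(mlead P) / mleadc P); set c := _ / _.
apply/eqP; rewrite -subr_eq0; set Z := w - _; apply/negPn/negP => Z0.
have ZP l : ('X_l * Z^`M(l)) * P = Z * ('X_l * P^`M(l)).
  rewrite -mulrA [RHS]mulrCA; congr (_ * _).
  by rewrite /Z mderivB mderivZ !mulrBl wP -!scalerAl [_^`M(l) * P]mulrC.
have coefE (p : {mpoly R[n]}) l m : ('X_l * p^`M(l))@_m = p@_m *+ m l.
  elim/mpolyind: p => [|d m' p _ _ IHp]; first by rewrite mderiv0 mulr0 mcoeff0 mul0rn.
  rewrite mderivD mulrDr !mcoeffD mulrnDl IHp mderivZ mderivX -!scalerAr !mcoeffZ.
  congr (_ + _); have [m'l|m'l] := posnP (m' l).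
    rewrite m'l mul0r mulr0 mcoeffX; case: eqP => [<-|_]; last by rewrite mulr0 mul0rn.
    by rewrite m'l.
  rewrite -mpolyXD addmC submK ?mcoeffX; last first.
    by apply/mnm_lepP=> i; rewrite mnm1E; case: eqP => [<-|_].
  by case: eqP => [<-|_]; rewrite ?mulr0 ?mul0rn // !mulr1 mulr_natr.
have lead_le (p : {mpoly R[n]}) l : (mlead ('X_l * p^`M(l)) <= mlead p)%O.
  have [->|q0] := eqVneq ('X_l * p^`M(l)) 0; first by rewrite mlead0 le0m.
  apply: msupp_le_mlead; rewrite mcoeff_msupp.
  apply: contraNneq (q0) => p0; rewrite -mleadc_eq0 coefE p0 mul0rn //.
have /mnmP eqlead l : mlead Z l = mlead P l.
  have := congr1 (fun q => q@_(mlead Z + mlead P)) (ZP l).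
  rewrite !mleadcMW ?lead_le // !coefE mulrnAl mulrnAr => /eqP.
  rewrite -subr_eq0; case: (ltngtP (mlead Z l) (mlead P l)) => // lt.
    rewrite -opprB oppr_eq0 -mulrnBr 1?ltnW // mulrn_eq0 subn_eq0 leqNgt lt.
    by rewrite mulf_eq0 !mleadc_eq0 (negPf Z0) (negPf P0).
  rewrite -mulrnBr 1?ltnW // mulrn_eq0 subn_eq0 leqNgt lt.
  by rewrite mulf_eq0 !mleadc_eq0 (negPf Z0) (negPf P0).
move/eqP: Z0; apply; apply/eqP; rewrite -mleadc_eq0 eqlead mcoeffB mcoeffZ.
by rewrite divfK ?subrr ?mleadc_eq0.
Qed.

Lemma mderiv_eq0_const (w : {mpoly R[n]}) :
  (forall l, w^`M(l) = 0) -> exists c, w = c%:MP.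
Proof.
move=> w0; have [||c ->] := @wronskian_eq0 w 1; first exact: oner_neq0.
  by move=> l; rewrite w0 mul0r -mpolyC1 mderivC mulr0.
by exists c; rewrite -mul_mpolyC mulr1.
Qed.
End Wronskian.

(** * Singling out one variable and freezing the others *)

Section Substitutions.
Variables (n : nat) (R : numFieldType).
Implicit Types (f g : {mpoly R[n]}) (p q : {poly R}) (l m j : 'I_n).
Implicit Types (y : 'I_n -> R) (s : seq 'I_n).

Definition embed l p : {mpoly R[n]} := horner_alg 'X_l p.
HB.instance Definition _ l :=
  GRing.LRMorphism.copy (embed l) (horner_alg ('X_l : {mpoly R[n]})).

(* [f] as a univariate polynomial in ['X_l]; its coefficients stay in
   [{mpoly R[n]}], though they do not involve ['X_l], so that evaluating the
   result at ['X_l] gives back [f]. *)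
Definition asuniv l f : {poly {mpoly R[n]}} :=
  mmap (polyC \o @mpolyC n R) (fun i => if i == l then 'X else ('X_i)%:P) f.
HB.instance Definition _ l := GRing.RMorphism.copy (asuniv l)
  (mmap (polyC \o @mpolyC n R) (fun i => if i == l then 'X else ('X_i)%:P)).

Definition restr y l f : {poly R} :=
  mmap (@polyC R) (fun i => if i == l then 'X else (y i)%:P) f.
HB.instance Definition _ y l := GRing.RMorphism.copy (restr y l)
  (mmap (@polyC R) (fun i => if i == l then 'X else (y i)%:P)).

(** The result stays in the same ring, so that variables can be frozen one after the other. *)
Definition freeze y s f : {mpoly R[n]} :=
  mmap (@mpolyC n R) (fun i => if i \in s then (y i)%:MP else 'X_i) f.
HB.instance Definition _ y s := GRing.RMorphism.copy (freeze y s)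
  (mmap (@mpolyC n R) (fun i => if i \in s then (y i)%:MP else 'X_i)).

Lemma embedC l c : embed l c%:P = c%:MP.
Proof. by rewrite /embed horner_algC -mul_mpolyC mulr1. Qed.

Lemma embedX l : embed l 'X = 'X_l.
Proof. exact: horner_algX. Qed.

Lemma embedZ l c p : embed l (c *: p) = c *: embed l p.
Proof. by rewrite -mul_polyC rmorphM /= embedC mul_mpolyC. Qed.

Lemma asunivC l c : asuniv l c%:MP = c%:MP%:P.
Proof. exact: mmapC. Qed.

Lemma asunivX l i : asuniv l 'X_i = if i == l then 'X else ('X_i)%:P.
Proof. by rewrite /asuniv mmapX mmap1U. Qed.

Lemma asunivB l f g : asuniv l (f - g) = asuniv l f - asuniv l g.
Proof. exact: rmorphB. Qed.

Lemma asunivM l f g : asuniv l (f * g) = asuniv l f * asuniv l g.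
Proof. exact: rmorphM. Qed.

Lemma asunivZ l c f : asuniv l (c *: f) = c%:MP *: asuniv l f.
Proof. by rewrite -mul_mpolyC asunivM asunivC mul_polyC. Qed.

Lemma restrC y l c : restr y l c%:MP = c%:P.
Proof. exact: mmapC. Qed.

Lemma restrX y l i : restr y l 'X_i = if i == l then 'X else (y i)%:P.
Proof. by rewrite /restr mmapX mmap1U. Qed.

Lemma freezeC y s c : freeze y s c%:MP = c%:MP.
Proof. exact: mmapC. Qed.

Lemma freezeX y s i : freeze y s 'X_i = if i \in s then (y i)%:MP else 'X_i.
Proof. by rewrite /freeze mmapX mmap1U. Qed.

Lemma asuniv_horner l c f :
  (asuniv l f).[c] = mmap (@mpolyC n R) (fun i => if i == l then c else 'X_i) f.
Proof.
apply: (mpoly_rmorph_ext (phi := horner_eval c \o asuniv l)) => [d|i] /=.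
  by rewrite asunivC /horner_eval hornerC mmapC.
rewrite asunivX mmapX mmap1U /horner_eval.
by case: eqP => _; rewrite ?hornerX ?hornerC.
Qed.

Lemma asunivK l f : (asuniv l f).['X_l] = f.
Proof.
rewrite asuniv_horner; apply: (mpoly_rmorph_ext (psi := idfun)) => [d|i] /=.
  exact: mmapC.
by rewrite mmapX mmap1U; case: eqP => // ->.
Qed.

Lemma asuniv_eq0 l f : (asuniv l f == 0) = (f == 0).
Proof.
apply/eqP/eqP => [f0|->]; last exact: rmorph0.
by rewrite -(asunivK l f) f0 horner0.
Qed.

Lemma mderivXU l m : ('X_m)^`M(l) = (m == l)%:R :> {mpoly R[n]}.
Proof.
rewrite mderivX mnm1E; case: eqP => [->|_]; last by rewrite scale0r.
rewrite scale1r -mpolyX0; congr 'X_[_].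
by apply/mnmP=> j'; rewrite mnmBE subnn mnm0E.
Qed.

Lemma asuniv_deriv l f : asuniv l f^`M(l) = (asuniv l f)^`().
Proof.
elim/mpoly_ring_ind: f => [c|i|f g IHf IHg|f g IHf IHg].
- by rewrite mderivC (rmorph0 (asuniv l)) asunivC derivC.
- rewrite mderivXU asunivX (rmorph_nat (asuniv l)); case: eqP => _.
    by rewrite derivX.
  by rewrite derivC.
- by rewrite mderivD !rmorphD /= IHf IHg derivD.
- by rewrite mderivM rmorphD !rmorphM /= IHf IHg derivM.
Qed.

Lemma coef_asuniv_mderiv l m f i : m != l ->
  (asuniv l f^`M(m))`_i = ((asuniv l f)`_i)^`M(m).
Proof.
move=> ml; elim/mpoly_ring_ind: f i => [c|j|f g IHf IHg|f g IHf IHg] i.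
- rewrite mderivC (rmorph0 (asuniv l)) asunivC [LHS]coef0 coefC.
  by rewrite (fun_if (mderiv m)) mderivC mderiv0 if_same.
- rewrite mderivXU (rmorph_nat (asuniv l)) -polyC_natr (coefC _%:R) asunivX.
  have [->|jl] := eqVneq j l.
    by rewrite [l == m]eq_sym (negPf ml) if_same coefX -mpolyC_nat mderivC.
  by rewrite (coefC 'X_j) (fun_if (mderiv m)) mderivXU mderiv0.
- rewrite mderivD !(rmorphD (asuniv l)) [LHS]coefD [X in _ = mderiv m X]coefD mderivD.
  by congr (_ + _); [exact: IHf | exact: IHg].
- rewrite mderivM (rmorphD (asuniv l)) !(rmorphM (asuniv l)) [LHS]coefD.
  rewrite [X in X + _]coefM [X in _ + X]coefM -big_split [X in _ = mderiv m X]coefM.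
  rewrite [RHS]raddf_sum; apply: eq_bigr => a _; rewrite [RHS]mderivM.
  by congr (_ * _ + _ * _); [exact: IHf | exact: IHg].
Qed.

Lemma size_asuniv_mderiv l m f : m != l ->
  (size (asuniv l f^`M(m)) <= size (asuniv l f))%N.
Proof.
move=> ml; apply/leq_sizeP => i fi.
by rewrite coef_asuniv_mderiv // nth_default // mderiv0.
Qed.

Lemma asuniv_embed l p : asuniv l (embed l p) = map_poly (@mpolyC n R) p.
Proof.
elim/poly_ind: p => [|p c IHp]; first by rewrite !rmorph0.
rewrite !rmorphD !rmorphM /= IHp embedX embedC asunivX asunivC eqxx.
by rewrite map_polyX map_polyC.
Qed.

Lemma asuniv_embed_neq l m p : m != l -> asuniv l (embed m p) = (embed m p)%:P.
Proof.
move=> ml; elim/poly_ind: p => [|p c IHp]; first by rewrite !rmorph0.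
by rewrite !rmorphD !rmorphM /= IHp embedX embedC asunivX asunivC (negPf ml).
Qed.

Lemma size_asuniv_embed l p : size (asuniv l (embed l p)) = size p.
Proof. by rewrite asuniv_embed size_map_inj_poly //; exact: (can_inj (@mpolyCK n R)). Qed.

Lemma embed_eq0 l p : (embed l p == 0) = (p == 0).
Proof. by rewrite -(asuniv_eq0 l) -size_poly_eq0 size_asuniv_embed size_poly_eq0. Qed.

Lemma mderiv_embed l m p :
  (embed m p)^`M(l) = if m == l then embed l p^`() else 0.
Proof.
elim/poly_ind: p => [|p c IHp].
  by rewrite derivC !rmorph0 mderiv0 if_same.
rewrite rmorphD rmorphM /= embedX embedC mderivD mderivM mderivC IHp mderivXU.
have [->|_] := eqVneq m l; last by rewrite !mul0r mulr0 !addr0.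
by rewrite derivD derivM derivX derivC !addr0 rmorphD !rmorphM /= embedX (rmorph1 (embed l)).
Qed.

Lemma freeze_nil y : freeze y [::] =1 id.
Proof.
apply: (mpoly_rmorph_ext (psi := idfun)) => [c|i] /=; first exact: freezeC.
by rewrite freezeX.
Qed.

Lemma freeze_cons y j s f : freeze y (j :: s) f = freeze y [:: j] (freeze y s f).
Proof.
move: f; apply: (mpoly_rmorph_ext (psi := freeze y [:: j] \o freeze y s)) => [c|i] /=.
  by rewrite !freezeC.
rewrite !freezeX inE; have [->|ij] := eqVneq i j.
  by case: (j \in s); rewrite ?freezeC // freezeX inE eqxx.
by case: (i \in s) => //=; rewrite ?freezeC ?freezeX ?inE ?(negPf ij).
Qed.

Lemma freeze1 y j f : freeze y [:: j] f = (asuniv j f).[(y j)%:MP].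
Proof.
rewrite asuniv_horner; move: f; apply: mpoly_rmorph_ext => [c|i] /=.
  by rewrite freezeC mmapC.
by rewrite freezeX mmapX mmap1U inE; case: eqP => // ->.
Qed.

Lemma meval_freeze y s f : (freeze y s f).@[y] = f.@[y].
Proof.
move: f; apply: (mpoly_rmorph_ext (phi := meval y \o freeze y s)
  (psi := meval y)) => [c|i] /=; first by rewrite freezeC.
by rewrite freezeX; case: (i \in s); rewrite ?mevalC ?mevalXU.
Qed.

Lemma embed_restr y l f : embed l (restr y l f) = freeze y (rem l (enum 'I_n)) f.
Proof.
move: f; apply: (mpoly_rmorph_ext (phi := embed l \o restr y l)) => [c|i] /=.
  by rewrite restrC embedC freezeC.
rewrite restrX freezeX mem_rem_uniq ?enum_uniq // !inE mem_enum andbT.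
by case: eqP => [->|_]; rewrite ?embedX ?embedC.
Qed.

Lemma restr_eval y l f : (restr y l f).[y l] = f.@[y].
Proof.
move: f; apply: (mpoly_rmorph_ext (phi := horner_eval (y l) \o restr y l)
  (psi := meval y)) => [c|i] /=; rewrite /horner_eval.
  by rewrite restrC hornerC mevalC.
by rewrite restrX mevalXU; case: eqP => [->|_]; rewrite ?hornerX ?hornerC.
Qed.

Lemma restr_deriv y l f : restr y l f^`M(l) = (restr y l f)^`().
Proof.
elim/mpoly_ring_ind: f => [c|i|f g IHf IHg|f g IHf IHg].
- by rewrite mderivC rmorph0 restrC derivC.
- rewrite mderivXU restrX rmorph_nat.
  by case: (i == l); rewrite ?derivX ?derivC.
- by rewrite mderivD !rmorphD /= IHf IHg derivD.
- by rewrite mderivM rmorphD !rmorphM /= IHf IHg derivM.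
Qed.

Lemma restr_embed y l p : restr y l (embed l p) = p.
Proof.
elim/poly_ind: p => [|p c IHp]; first by rewrite !rmorph0.
by rewrite !rmorphD !rmorphM /= IHp embedX embedC restrX restrC eqxx.
Qed.

Lemma eq_freeze y1 y2 s : {in s, y1 =1 y2} -> freeze y1 s =1 freeze y2 s.
Proof.
move=> eqy; apply: mpoly_rmorph_ext => [c|i] /=; first by rewrite !freezeC.
by rewrite !freezeX; case: ifP => // /eqy ->.
Qed.

(** The constants 0, 1, ..., [size Q - 1] are pairwise distinct in characteristic 0, and they are
    too many to all be roots. *)
Lemma poly_nonroot (Q : {poly {mpoly R[n]}}) : Q != 0 ->
  exists c : R, Q.[c%:MP] != 0.
Proof.
move=> Q0; apply: contrapT => /forallNP Qroot.
pose rs := [seq (i%:R : R)%:MP_[n] | i <- iota 0 (size Q)].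
have /(max_poly_roots Q0) : all (root Q) rs.
  apply/allP => _ /mapP[i _ ->]; apply/rootP/eqP.
  by have /negP := Qroot i%:R; rewrite negbK.
rewrite size_map size_iota ltnn => /(_ _)/notF; apply.
rewrite map_inj_uniq ?iota_uniq // => i j /(can_inj (@mpolyCK n R)) /eqP.
by rewrite eqr_nat => /eqP.
Qed.

(** Freeze the variables one at a time, using [poly_nonroot] to pick each value so that the
    polynomial stays nonzero. *)
Lemma mpoly_nonroot f : f != 0 -> exists y, f.@[y] != 0.
Proof.
move=> f0; suff [y fy] : exists y, freeze y (enum 'I_n) f != 0.
  exists y; apply: contraNneq fy => fy0.
  suff -> : freeze y (enum 'I_n) f = (f.@[y])%:MP by rewrite fy0 mpolyC0.
  move: f {f0 fy0}; apply: (mpoly_rmorph_ext (psi := @mpolyC n R \o meval y)) => [c|i] /=.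
    by rewrite freezeC mevalC.
  by rewrite freezeX mem_enum mevalXU.
elim: (enum 'I_n) (enum_uniq 'I_n) => [_|j s IHs /= /andP[js /IHs[y fy]]].
  by exists (fun=> 0); rewrite freeze_nil.
rewrite -(asuniv_eq0 j) in fy; have [c yc] := poly_nonroot fy.
exists (fun i => if i == j then c else y i).
rewrite freeze_cons freeze1 eqxx.
rewrite (@eq_freeze _ y) // => i si.
by case: eqP => // eij; rewrite -eij si in js.
Qed.

End Substitutions.

(** * Rank at most one as vanishing 2 x 2 minors *)

Lemma minor2_eq0 (F : fieldType) (r c : nat) (A : 'M[F]_(r, c)) i i' l l' :
  (\rank A <= 1)%N -> A i l * A i' l' = A i l' * A i' l.
Proof.
(* The rank factorization writes [A] as one column times one row, or as zero. *)
move=> rkA; have := mulmx_base A; move: (col_base A) (row_base A) rkA.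
case: (\rank A) => [|[|//]] C B _ <-; rewrite !mxE ?big_ord0 ?mul0r // !big_ord1.
by ring.
Qed.

(** Both products expand to double sums over pairs of coefficients that agree term by term, so the
    two evaluation points may differ. *)
Lemma horner_cross (S : comNzRingType) (P Q : {poly S}) u v :
    (forall a b, P`_a * Q`_b = Q`_a * P`_b) ->
  P.[u] * Q.[v] = Q.[u] * P.[v].
Proof.
move=> PQ; pose N := maxn (size P) (size Q).
rewrite !(@horner_coef_wide _ N) ?leq_maxl ?leq_maxr // !big_distrlr /=.
apply: eq_bigr => a _; apply: eq_bigr => b _.
by rewrite mulrACA PQ mulrACA.
Qed.

Section RankOne.
Variables (n : nat) (R : realType).
Implicit Types (f : {mpoly R[n]}) (j : 'I_n) (y : 'I_n -> R).

(** Puts the coefficients [mcoefv f j i] back into the ring of [f], where they become the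
    coefficients of [asuniv j f]. *)
Definition insertv j : {mpoly R[n.-1]} -> {mpoly R[n]} :=
  mmap (@mpolyC n R) (fun l => 'X_(lift j l)).
HB.instance Definition _ j := GRing.RMorphism.copy (insertv j)
  (mmap (@mpolyC n R) (fun l => 'X_(lift j l))).

Lemma mderiv_insertv j (l : 'I_n.-1) (q : {mpoly R[n.-1]}) :
  (insertv j q)^`M(lift j l) = insertv j q^`M(l).
Proof.
elim/mpoly_ring_ind: q => [c|i|p q IHp IHq|p q IHp IHq].
- by rewrite mderivC (rmorph0 (insertv j)) /insertv mmapC mderivC.
- rewrite mderivXU (rmorph_nat (insertv j)) /insertv mmapX mmap1U mderivXU.
  by rewrite (inj_eq lift_inj).
- by rewrite !(rmorphD (insertv j), mderivD) IHp IHq.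
- by rewrite !(rmorphM (insertv j), rmorphD (insertv j), mderivM) IHp IHq.
Qed.

Lemma coef_asuniv j f a : (asuniv j f)`_a = insertv j (mcoefv f j a).
Proof.
rewrite /asuniv /mmap /mcoefv coef_sum raddf_sum [RHS]big_mkcond.
apply: eq_bigr => m _; rewrite /mmap1 (bigD1_ord j) //= eqxx.
rewrite (eq_bigr (fun l => ('X_(lift j l) ^+ m (lift j l))%:P)); last first.
  by move=> l _; rewrite eq_sym (negPf (neq_lift _ _)) polyC_exp.
rewrite -rmorph_prod /= [_ * (_)%:P]mulrC coefCM coefCM coefXn eq_sym.
case: eqP => _; last by rewrite !mulr0.
rewrite -mul_mpolyC mulr1 (rmorphM (insertv j)) /= /insertv mmapC mmapX /mmap1.
by congr (_ * _); apply: eq_bigr => l _; rewrite mnmE.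
Qed.

(** Differentiation in ['X_l] or ['X_m] acts on the coefficients of [asuniv j f], so the identity is
    the vanishing of a 2 x 2 minor of [jacobianv f j], carried over by [insertv]. *)
Lemma rankv_cross f j (l m : 'I_n) a b : (mprank f <= 1)%N -> l != j -> m != j ->
  (asuniv j f^`M(l))`_a * (asuniv j f^`M(m))`_b =
  (asuniv j f^`M(m))`_a * (asuniv j f^`M(l))`_b.
Proof.
move=> rk lj mj.
have [l' ->] : exists l' : 'I_n.-1, l = lift j l'.
  by case: (unliftP j l) lj => [l' ->|->]; [exists l' | rewrite eqxx].
have [m' ->] : exists m' : 'I_n.-1, m = lift j m'.
  by case: (unliftP j m) mj => [m' ->|->]; [exists m' | rewrite eqxx].
have coefE (i : 'I_n.-1) c :
    (asuniv j f^`M(lift j i))`_c = insertv j (mcoefv f j c)^`M(i).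
  rewrite coef_asuniv_mderiv ?[lift j i == j]eq_sym ?neq_lift //.
  by rewrite coef_asuniv mderiv_insertv.
refine (etrans (congr2 *%R (coefE l' a) (coefE m' b)) _).
refine (etrans _ (esym (congr2 *%R (coefE m' a) (coefE l' b)))).
rewrite -!(rmorphM (insertv j)); congr insertv.
(* Indices above [mdegv f j] have no row in the Jacobian; their coefficients are zero, so both sides
   vanish. *)
have coef0 c : (mdegv f j < c)%N -> mcoefv f j c = 0.
  move=> degc; rewrite /mcoefv big_seq_cond big1 // => m0 /andP[fm0 /eqP m0c].
  move: degc; rewrite ltnNge -m0c.
  by rewrite [(_ <= _)%N](@leq_bigmax_seq _ _ predT (fun m : 'X_{1..n} => m j)) ?fm0.
have [/coef0->|le_a] := ltnP (mdegv f j) a; first by rewrite !mderiv0 !mul0r.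
have [/coef0->|le_b] := ltnP (mdegv f j) b; first by rewrite !mderiv0 !mulr0.
have rkj : (rankv f j <= 1)%N.
  by apply: leq_trans rk; exact: (leq_bigmax (F := fun j => rankv f j)).
have := @minor2_eq0 _ _ _ _ (Ordinal (le_a : (a < _.+1)%N))
  (Ordinal (le_b : (b < _.+1)%N)) l' m' rkj.
by rewrite !mxE /= -!rmorphM => /eqP; rewrite tofrac_eq => /eqP.
Qed.

End RankOne.

(** Transitivity of a/b = c/d = e/g, with cleared denominators. *)
Lemma cross_trans (S : idomainType) (a b c d e g : S) :
  c != 0 -> a * d = b * c -> c * g = d * e -> a * g = b * e.
Proof.
move=> c0 ad cg; apply: (mulIf c0).
by rewrite -mulrA [g * c]mulrC cg mulrA ad mulrAC.
Qed.

Lemma exists_third (n : nat) (l m : 'I_n) : (3 <= n)%N ->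
  exists j, j != l /\ j != m.
Proof.
move=> n3; have : (0 < #|~: [set l; m]|)%N.
  rewrite cardsCs setCK card_ord subn_gt0; apply: leq_trans n3.
  by rewrite cards2; case: (_ != _).
by case/card_gt0P => j; rewrite !inE negb_or => /andP[jl jm]; exists j.
Qed.

(** * Separating the variables in the ratios of partial derivatives *)

Section Slopes.
Variables (n : nat) (R : realType) (f : {mpoly R[n]}) (y : 'I_n -> R).
Hypothesis rkf : (mprank f <= 1)%N.
Hypothesis fy : forall l, (f^`M(l)).@[y] != 0.

Lemma freeze_neq0 s (g : {mpoly R[n]}) : g.@[y] != 0 -> freeze y s g != 0.
Proof. by apply: contraNneq => g0; rewrite -(meval_freeze y s) g0 meval0. Qed.

Lemma restr_neq0 l (g : {mpoly R[n]}) : g.@[y] != 0 -> restr y l g != 0.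
Proof. by apply: contraNneq => g0; rewrite -(restr_eval y l) g0 horner0. Qed.

(** The ratio f_l / f_m is unchanged when ['X_j] is frozen: [horner_cross] applies with the
    evaluation points ['X_j] and [y j]. *)
Lemma freeze1_cross (j l m : 'I_n) : l != j -> m != j ->
  f^`M(l) * freeze y [:: j] f^`M(m) = f^`M(m) * freeze y [:: j] f^`M(l).
Proof.
move=> lj mj; rewrite !freeze1.
refine (etrans (congr2 *%R (esym (asunivK j _)) erefl) _).
refine (etrans _ (congr2 *%R (asunivK j _) erefl)).
by apply: horner_cross => a b; exact: rankv_cross.
Qed.

Lemma freeze_cross s (l m : 'I_n) : l \notin s -> m \notin s ->
  f^`M(l) * freeze y s f^`M(m) = f^`M(m) * freeze y s f^`M(l).
Proof.
elim: s => [|j s IHs]; first by rewrite !freeze_nil mulrC.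
rewrite !inE !negb_or => /andP[lj ls] /andP[mj ms]; rewrite !(freeze_cons y j s).
apply: cross_trans (freeze1_cross lj mj) _; first exact: freeze_neq0.
by rewrite -!rmorphM IHs.
Qed.

Lemma freeze_eqi s1 s2 : s1 =i s2 -> freeze y s1 =1 freeze y s2.
Proof.
move=> eqs; apply: mpoly_rmorph_ext => [c|i] /=; first by rewrite !freezeC.
by rewrite !freezeX eqs.
Qed.

(** The ratio f_l / f_j is unchanged when all other variables are frozen; freezing ['X_j] on both
    sides then leaves a function of ['X_l] alone. *)
Lemma freeze1_embed (l j : 'I_n) : l != j ->
  freeze y [:: j] f^`M(l) * embed l (restr y l f^`M(j)) =
  freeze y [:: j] f^`M(j) * embed l (restr y l f^`M(l)).
Proof.
move=> lj; pose s := [seq i <- enum 'I_n | (i != l) && (i != j)].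
have E g : embed l (restr y l g) = freeze y [:: j] (freeze y s g).
  rewrite embed_restr -freeze_cons; apply: freeze_eqi => i.
  have si : (i \in s) = (i != l) && (i != j) by rewrite mem_filter mem_enum andbT.
  rewrite mem_rem_uniq ?enum_uniq // !inE ?mem_enum ?andbT si.
  by have [->|_] := eqVneq i j; rewrite ?andbT ?[j == l]eq_sym ?lj.
rewrite !E -!rmorphM freeze_cross // mem_filter eqxx ?andbF //.
Qed.

(** On the line through [y] along ['X_l], the ratio f_j / f_m keeps its value at [y], because it
    does not involve ['X_l]. *)
Lemma restr_cross (l j m : 'I_n) : j != l -> m != l ->
  restr y l f^`M(j) * ((f^`M(m)).@[y])%:P = restr y l f^`M(m) * ((f^`M(j)).@[y])%:P.
Proof.
move=> jl ml; have E g : restr y l (freeze y [:: l] g) = (g.@[y])%:P.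
  move: g; apply: (mpoly_rmorph_ext (phi := restr y l \o freeze y [:: l])
    (psi := polyC \o meval y)) => [c|i] /=; first by rewrite freezeC restrC mevalC.
  rewrite freezeX inE mevalXU; case: eqP => [->|/eqP/negPf il].
    by rewrite restrC.
  by rewrite restrX il.
by rewrite -!E -!rmorphM freeze1_cross.
Qed.

(** Freezing ['X_j] does not change f_l / f_m. Once it is frozen, write the ratio as (f_l / f_j) /
    (f_m / f_j), where by [freeze1_embed] the numerator depends on ['X_l] only and the denominator
    on ['X_m] only. *)
Lemma three_cross (l m j : 'I_n) : l != j -> m != j ->
  f^`M(l) * embed l (restr y l f^`M(j)) * embed m (restr y m f^`M(m)) =
  f^`M(m) * embed m (restr y m f^`M(j)) * embed l (restr y l f^`M(l)).
Proof.
move=> lj mj; have := freeze1_cross lj mj.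
have := freeze1_embed lj; have := freeze1_embed mj.
have := freeze_neq0 [:: j] (fy j); have := freeze_neq0 [:: j] (fy l).
move: (freeze y [:: j] f^`M(l)) (freeze y [:: j] f^`M(m)) (freeze y [:: j] f^`M(j)).
move: (embed l (restr y l f^`M(j))) (embed l (restr y l f^`M(l))).
move: (embed m (restr y m f^`M(j))) (embed m (restr y m f^`M(m))).
move: f^`M(l) f^`M(m) => fl fm umj umm ulj ull Nl Nm Nj Nl0 Nj0 E1 E2 E3.
apply: (mulfI Nl0); apply: (mulfI Nj0).
transitivity ((fl * (Nj * umm)) * (Nl * ulj)); first by ring.
rewrite -E1 E2; transitivity ((fl * Nm) * umj * (Nj * ull)); first by ring.
by rewrite E3; ring.
Qed.

End Slopes.

Lemma exists_slopes (n : nat) (R : realType) (f : {mpoly R[n]}) :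
    (3 <= n)%N -> (mprank f <= 1)%N -> (forall l, f^`M(l) != 0) ->
  exists a b : 'I_n -> {poly R},
    [/\ forall l, coprimep (a l) (b l), forall l, a l != 0, forall l, b l != 0 &
        forall l m, embed l (a l) * embed m (b m) * f^`M(m) =
                    embed m (a m) * embed l (b l) * f^`M(l)].
Proof.
move=> n3 rkf f0; have [y] : exists y, (\prod_l f^`M(l)).@[y] != 0.
  by apply: mpoly_nonroot; apply/prodf_neq0 => l _.
rewrite rmorph_prod => /prodf_neq0 fy0.
have fy l : (f^`M(l)).@[y] != 0 by exact: fy0.
have third l m := exists_third l m n3.
have /choice[nu nuP] : forall l : 'I_n, exists j, j != l.
  by move=> l; have [j []] := third l l; exists j.
pose a0 l := restr y l f^`M(l).
(* By [restr_cross], dividing by the value at [y] makes this independent of the choice of [nu l], so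
   one [b0 l] serves all pairs of variables. *)
pose b0 l := ((f^`M(nu l)).@[y])^-1 *: restr y l f^`M(nu l).
have a0_neq0 l : a0 l != 0 by exact: restr_neq0.
have b0_neq0 l : b0 l != 0 by rewrite scaler_eq0 invr_eq0 negb_or fy restr_neq0.
have b0E l j : j != l -> restr y l f^`M(j) = (f^`M(j)).@[y] *: b0 l.
  move=> jl; have := restr_cross y rkf jl (nuP l).
  rewrite mulrC mul_polyC mulrC mul_polyC => E.
  by rewrite /b0 scalerA mulrC -scalerA -E scalerA mulVf ?scale1r.
have cross0 l m : embed l (a0 l) * embed m (b0 m) * f^`M(m) =
                  embed m (a0 m) * embed l (b0 l) * f^`M(l).
  have [j [jl jm]] := third l m.
  have := three_cross rkf fy (l := l) (m := m) (j := j).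
  rewrite eq_sym jl eq_sym jm => /(_ isT isT).
  rewrite (b0E _ _ jl) (b0E _ _ jm) (embedZ l _ (b0 l)) (embedZ m _ (b0 m)) -/(a0 l) -/(a0 m).
  move: f^`M(l) f^`M(m) (embed l (a0 l)) (embed m (a0 m)) => fl fm al am.
  move: (embed l (b0 l)) (embed m (b0 m)) => bl bm.
  rewrite -!scalerAr -!scalerAl => /(scalerI (fy j)) E.
  by transitivity (fm * bm * al); [ring | rewrite -E; ring].
pose g l := gcdp (a0 l) (b0 l).
have aE l : (a0 l %/ g l) * g l = a0 l by rewrite divpK // dvdp_gcdl.
have bE l : (b0 l %/ g l) * g l = b0 l by rewrite divpK // dvdp_gcdr.
have g0 l : embed l (g l) != 0.
  by rewrite embed_eq0 gcdp_eq0 negb_and a0_neq0.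
exists (fun l => a0 l %/ g l), (fun l => b0 l %/ g l); split=> [l|l|l|l m].
- by rewrite coprimep_div_gcd // a0_neq0.
- by apply: contraNneq (a0_neq0 l) => a0l; rewrite -aE a0l mul0r.
- by apply: contraNneq (b0_neq0 l) => b0l; rewrite -bE b0l mul0r.
have := cross0 l m.
rewrite -[in X in X -> _](aE l) -[in X in X -> _](aE m).
rewrite -[in X in X -> _](bE l) -[in X in X -> _](bE m) !rmorphM /=.
move: (g0 l) (g0 m); move: (embed l (g l)) (embed m (g m)).
move: (embed l (a0 l %/ g l)) (embed m (a0 m %/ g m)).
move: (embed l (b0 l %/ g l)) (embed m (b0 m %/ g m)).
move: f^`M(l) f^`M(m) => fl fm bl bm al am gl gm gl0 gm0 E.
apply: (mulfI gl0); apply: (mulfI gm0).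
transitivity (al * gl * (bm * gm) * fm); first by ring.
by rewrite E; ring.
Qed.

(** * Univariate preliminaries and divisibility by one-variable polynomials *)

Lemma coefM_top (S : nzRingType) (p q : {poly S}) i j :
  (size p <= i.+1)%N -> (size q <= j.+1)%N -> (p * q)`_(i + j) = p`_i * q`_j.
Proof.
move=> pi qj; rewrite coefM (bigD1 (inord i)) //= inordK ?ltnS ?leq_addr // addKn.
rewrite big1 ?addr0 // => k; rewrite -val_eqE /= inordK ?ltnS ?leq_addr // => ki.
case: (ltngtP k i) ki => // [lt|gt] _.
  rewrite [q`__]nth_default ?mulr0 //; apply: leq_trans qj _.
  by rewrite ltn_subRL ltn_add2r.
by rewrite [p`__]nth_default ?mul0r //; apply: leq_trans pi _.
Qed.

Lemma exists_antideriv (R : numFieldType) (p : {poly R}) :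
  exists q : {poly R}, q^`() = p.
Proof.
exists (\poly_(i < (size p).+1) (p`_i.-1 / i%:R)); apply/polyP => i.
rewrite coef_deriv coef_poly ltnS /=; case: ltnP => [_|le]; last first.
  by rewrite mul0rn nth_default.
by rewrite -[LHS]mulr_natr divfK ?pnatr_eq0.
Qed.

Section EmbedDivision.
Variables (n : nat) (R : numFieldType).
Implicit Types (l m : 'I_n) (p c : {poly R}) (T Q : {mpoly R[n]}).

(** Divide [Q] by [embed l p] as polynomials in ['X_l]; the leading coefficient of the divisor is a
    nonzero constant. Multiplied by [embed m c], which is free of ['X_l], the remainder becomes a
    multiple of the divisor of smaller degree, hence zero. *)
Lemma embed_dvdl l m p c T Q : p != 0 -> c != 0 -> m != l ->
  embed l p * T = embed m c * Q -> exists Q', Q = embed l p * Q'.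
Proof.
move=> p0 c0 ml E; pose P := asuniv l (embed l p); pose U := asuniv l Q.
have unitP : lead_coef P \is a GRing.unit.
  rewrite /P asuniv_embed lead_coef_map_inj //; last exact: (can_inj (@mpolyCK n R)).
  by apply: (rmorph_unit (mpolyC n (R := R))); rewrite unitfE lead_coef_eq0.
have P0 : P != 0 by rewrite asuniv_eq0 embed_eq0.
have divU := Pdiv.IdomainUnit.divp_eq unitP U.
have modU0 : U %% P = 0.
  have : embed m c *: (U %% P) = P * (asuniv l T - embed m c *: (U %/ P)).
    have := congr1 (asuniv l) E; rewrite !rmorphM /= (asuniv_embed_neq _ ml).
    rewrite -/P -/U mul_polyC => E'.
    have -> : U %% P = U - U %/ P * P by apply/eqP; rewrite eq_sym subr_eq addrC -divU.
    by rewrite mulrBr E' -scalerAr scalerBr [P * _]mulrC.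
  move: (asuniv l T - _) => D ED.
  have : size (P * D) = size (U %% P).
    by rewrite -ED size_scale // embed_eq0.
  have [D0|D0] := eqVneq D 0.
    by rewrite D0 mulr0 size_poly0 => /esym/eqP; rewrite size_poly_eq0 => /eqP.
  have := ltn_modp U P; rewrite P0 => /[swap] <-.
  by rewrite size_mul // (polySpred D0) addnS /= ltnNge leq_addr.
exists (U %/ P).['X_l]; rewrite -{1}(asunivK l Q) -/U.
rewrite {1}divU modU0 addr0 hornerM mulrC; congr (_ * _).
exact: asunivK.
Qed.


Lemma embed_coprime l p q T Q : coprimep p q ->
  embed l q * T = embed l p * Q -> exists T', T = embed l p * T'.
Proof.
move=> /Bezout_eq1_coprimepP[[u v] /= uv] E.
exists (embed l u * T + embed l v * Q); rewrite mulrDr.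
rewrite mulrA [_ * (embed l v * Q)]mulrCA -E mulrA -mulrDl -!rmorphM -rmorphD /=.
by rewrite [p * u]mulrC uv rmorph1 mul1r.
Qed.

End EmbedDivision.

(** * The derivation D given by the slopes a_l / b_l, and its eigenvectors *)

Section Slope.
Variables (n : nat) (R : numFieldType) (a b : 'I_n -> {poly R}).
Hypotheses (a0 : forall l, a l != 0) (b0 : forall l, b l != 0).
Hypothesis n2 : (1 < n)%N.
Implicit Types (g G w W F : {mpoly R[n]}) (l m : 'I_n).

Local Notation A l := (embed l (a l)).
Local Notation B l := (embed l (b l)).

(* [slope g G] says that [G] is the derivative of [g] with respect to a formal
   parameter [t] with [dt = \sum_l a_l(x_l) / b_l(x_l) dx_l]. *)
Definition slope g G := forall l, A l * G = B l * g^`M(l).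

Lemma A_neq0 l : A l != 0. Proof. by rewrite embed_eq0. Qed.
Lemma B_neq0 l : B l != 0. Proof. by rewrite embed_eq0. Qed.
Hint Resolve A_neq0 B_neq0 : core.

Lemma other l : exists m : 'I_n, m != l.
Proof.
have : (0 < #|~: [set l]|)%N by rewrite cardsCs setCK card_ord cards1 subn_gt0.
by case/card_gt0P => m; rewrite !inE => ml; exists m.
Qed.

(** By [embed_dvdl], with some m other than l, a_l divides b_l g_l, hence g_l by coprimality. So b_l
    g_l / a_l is a polynomial, and the cross relations make it independent of l. *)
Lemma cross_slope g : (forall l, coprimep (a l) (b l)) ->
    (forall l m, A l * B m * g^`M(m) = A m * B l * g^`M(l)) ->
  exists G, slope g G.
Proof.
move=> cop cross.
have /choice[T TE] : forall l, exists T, g^`M(l) = A l * T.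
  move=> l; have [m ml] := other l.
  have E : A l * (B m * g^`M(m)) = A m * (B l * g^`M(l)) by rewrite !mulrA cross.
  have [Q EQ] := embed_dvdl (a0 l) (a0 m) ml E.
  exact: embed_coprime (cop l) EQ.
pose l0 := Ordinal n2; exists (B l0 * T l0) => l.
apply: (mulfI (A_neq0 l0)); have := cross l l0; rewrite !TE.
move: (A l) (B l) (A l0) (B l0) (T l) (T l0) => al bl al0 bl0 tl tl0 E.
by transitivity (al * bl0 * (al0 * tl0)); [ring | rewrite E; ring].
Qed.

(** For distinct l and m, differentiating a_l G = b_l g_l in ['X_m] gives a_l G_m = b_l g_lm. By the
    symmetry of g_lm, [G] satisfies the relations of [cross_slope]. *)
Lemma slope_deriv g G : (forall l, coprimep (a l) (b l)) ->
  slope g G -> exists H, slope G H.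
Proof.
move=> cop gG; apply: cross_slope => // l m.
have [->|lm] := eqVneq l m; first by [].
have D l' m' : l' != m' -> A l' * G^`M(m') = B l' * g^`M(l')^`M(m').
  move=> /negPf lm'; have := congr1 (mderiv m') (gG l').
  by rewrite !mderivM !mderiv_embed lm' !mul0r !add0r.
have := D l m lm; have := D m l; rewrite eq_sym lm mderiv_comm => /(_ isT).
move: (A l) (B l) (A m) (B m) => al bl am bm.
move: G^`M(m) G^`M(l) (g^`M(l)^`M(m)) => Gm Gl glm E1 E2.
by rewrite -mulrA mulrCA E2 mulrCA -E1; ring.
Qed.

Lemma slopeC c : slope c%:MP 0.
Proof. by move=> l; rewrite mderivC !mulr0. Qed.

Lemma slopeD g G w W : slope g G -> slope w W -> slope (g + w) (G + W).
Proof. by move=> gG wW l; rewrite mderivD !mulrDr gG wW. Qed.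

Lemma slopeZ c g G : slope g G -> slope (c *: g) (c *: G).
Proof. by move=> gG l; rewrite mderivZ -!scalerAr gG. Qed.

Lemma slopeB g G w W : slope g G -> slope w W -> slope (g - w) (G - W).
Proof. by move=> gG wW l; rewrite mderivB !mulrBr gG wW. Qed.

Lemma slopeM g G w W : slope g G -> slope w W -> slope (g * w) (G * w + g * W).
Proof.
move=> gG wW l; rewrite mderivM; have := gG l; have := wW l.
move: (A l) (B l) g^`M(l) w^`M(l) => al bl gl wl Ew Eg.
by rewrite mulrDr mulrA Eg mulrCA Ew; ring.
Qed.

Lemma slope0_const g : slope g 0 -> exists c, g = c%:MP.
Proof.
move=> g0; apply: mderiv_eq0_const => l; apply: (mulfI (B_neq0 l)).
by rewrite -g0 !mulr0.
Qed.

Lemma slope_horner w W (h : {poly R}) : slope w W ->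
  slope (horner_alg w h) (horner_alg w h^`() * W).
Proof.
move=> wW; elim/poly_ind: h => [|h c IHh].
  by rewrite derivC !rmorph0 mul0r -mpolyC0; exact: slopeC.
rewrite derivD derivM derivX derivC addr0 mulr1 !rmorphD !rmorphM /=.
rewrite !horner_algX horner_algC -mul_mpolyC mulr1.
have -> : (horner_alg w h^`() * w + horner_alg w h) * W =
          horner_alg w h^`() * W * w + horner_alg w h * W + 0 by ring.
by apply: slopeD; [apply: slopeM | exact: slopeC].
Qed.

Lemma slope_eigenX F nu k : slope F (nu *: F) ->
  slope (F ^+ k) ((k%:R * nu) *: F ^+ k).
Proof.
move=> FF; elim: k => [|k IHk].
  by rewrite expr0 mul0r scale0r -mpolyC1; exact: slopeC.
rewrite exprS -[in X in slope _ X]natr1 mulrDl mul1r scalerDl addrC.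
by rewrite scalerAl [X in _ + X]scalerAr; exact: slopeM.
Qed.

(** The equal eigenvalues give F_l P = F P_l for every l. *)
Lemma slope_eigen_uniq F P nu : P != 0 -> slope F (nu *: F) -> slope P (nu *: P) ->
  exists c, F = c *: P.
Proof.
move=> P0 FF PP; apply: wronskian_eq0 => // l; apply: (mulfI (B_neq0 l)).
rewrite mulrA -FF mulrCA -PP -!mul_mpolyC; move: (A l) => al; by ring.
Qed.

Lemma mderiv_prod_embed l (q : 'I_n -> {poly R}) :
  (\prod_j embed j (q j))^`M(l) =
  embed l (q l)^`() * \prod_(j | j != l) embed j (q j).
Proof.
rewrite (bigD1 l) //= mderivM mderiv_embed eqxx.
suff -> : (\prod_(j | j != l) embed j (q j))^`M(l) = 0 by rewrite mulr0 addr0.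
elim/big_rec: _ => [|j P jl IH]; first by rewrite -mpolyC1 mderivC.
by rewrite mderivM IH mulr0 mderiv_embed (negPf jl) mul0r add0r.
Qed.

(** The slope relation in ['X_l], restricted to the line through [y] along ['X_l], is a univariate
    equation for the factor at l. The product of these factors therefore has the same eigenvalue
    [nu], and [slope_eigen_uniq] applies. *)
Lemma slope_eigen_prod F nu y : F.@[y] != 0 -> slope F (nu *: F) ->
  exists c, F = c *: \prod_l embed l (restr y l F).
Proof.
move=> Fy FF; apply: (@slope_eigen_uniq _ _ nu) => //.
  apply/prodf_neq0 => l _; rewrite embed_eq0.
  by apply: contraNneq Fy => F0; rewrite -(restr_eval y l) F0 horner0.
move=> l; rewrite mderiv_prod_embed (bigD1 l) //= scalerAl !mulrA; congr (_ * _).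
have := congr1 (restr y l) (FF l).
rewrite !rmorphM /= !restr_embed restr_deriv -mul_mpolyC rmorphM /= restrC.
by move=> /(congr1 (embed l)); rewrite !rmorphM /= embedC mul_mpolyC.
Qed.

End Slope.

Lemma horner_alg_comp (R : comNzRingType) (S : comAlgType R) (u : S) (p q : {poly R}) :
  horner_alg u (p \Po q) = horner_alg (horner_alg u q) p.
Proof.
elim/poly_ind: p => [|p c IHp]; first by rewrite comp_poly0 !rmorph0.
rewrite comp_polyD comp_polyM comp_polyX comp_polyC !rmorphD !rmorphM /= IHp.
by rewrite !horner_algC horner_algX.
Qed.

Lemma horner_algZ (R : comNzRingType) (S : comAlgType R) (u : S) c (p : {poly R}) :
  horner_alg u (c *: p) = c *: horner_alg u p.
Proof. by rewrite -mul_polyC rmorphM /= horner_algC -scalerAl mul1r. Qed.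

(** * Degree counts for univariate relations PA PG = PB p' *)

Section PolyDeriv.
Variable S : idomainType.
Hypothesis char0 : forall d, d.+1%:R != 0 :> S.
Implicit Types p PA PB PG : {poly S}.

Lemma size_deriv_char0 p : size p^`() = (size p).-1.
Proof.
have [->|p0] := eqVneq p 0; first by rewrite derivC size_poly0.
have := lt_size_deriv p0; rewrite {1}(polySpred p0) ltnS => le.
apply/eqP; rewrite eqn_leq le /=.
case sp: (size p).-1 => [|d] //; rewrite ltnNge; apply/negP => /leq_sizeP/(_ d (leqnn d)).
rewrite coef_deriv -mulr_natr => /eqP; rewrite mulf_eq0 (negPf (char0 d)) orbF.
by rewrite -sp -lead_coefE lead_coef_eq0 (negPf p0).
Qed.

(** Here deg PB = deg PA + deg PG - deg p', while deg PG <= deg p = deg p' + 1. *)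
Lemma size_deriv_ratio p PA PB PG : PA != 0 -> PB != 0 -> (1 < size p)%N ->
  (size PG <= size p)%N -> PA * PG = PB * p^`() -> (size PB <= (size PA).+1)%N.
Proof.
move=> A0 B0 p1 sG E; have sp := size_deriv_char0 p.
have p'0 : p^`() != 0 by rewrite -size_poly_gt0 sp; lia.
have G0 : PG != 0 by apply: contraNneq (mulf_neq0 B0 p'0) => G0; rewrite -E G0 mulr0.
have := congr1 (fun q : {poly S} => size q) E; rewrite !size_mul // sp.
move: A0 B0 G0; rewrite -!size_poly_gt0; lia.
Qed.

Lemma size_deriv_ratio_sub p PA PB PG r : PA != 0 ->
    (size PB <= (size PA).+1)%N -> (size PG <= size p)%N ->
    PA * PG = PB * p^`() -> r * lead_coef PA = PB`_(size PA) ->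
  (size (PG - ((size p).-1%:R * r) *: p)%R <= (size p).-1)%N.
Proof.
move=> A0 sB sG E rE; have sp := size_deriv_char0 p.
have sA : (0 < size PA)%N by rewrite size_poly_gt0.
case s1 : (size p) sp sG => [|[|d]] //= sp sG.
- by move: sG; rewrite leqn0 size_poly_eq0 => /eqP ->; rewrite mul0r scale0r subr0 size_poly0.
- move: sp => /eqP; rewrite size_poly_eq0 => /eqP p'0; move: E; rewrite p'0 mulr0.
  move/eqP; rewrite mulf_eq0 (negPf A0) => /eqP ->.
  by rewrite mul0r scale0r subr0 size_poly0.
apply/leq_sizeP => i; rewrite leq_eqVlt => /predU1P[<-|di]; last first.
  rewrite coefB coefZ [PG`__]nth_default; last exact: leq_trans sG di.
  by rewrite [p`__]nth_default ?s1 // mulr0 subr0.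
(* Neither side exceeds degree deg PA + deg p; comparing coefficients there determines that of [PG]
   in degree deg p. *)
have := congr1 (fun q : {poly S} => q`_((size PA).-1 + d.+1)) E.
rewrite coefM_top ?prednK // addnS -addSn prednK // coefM_top ?sp //.
rewrite coef_deriv -lead_coefE -rE -mulr_natl => E2.
apply: (@mulfI _ (lead_coef PA)); first by rewrite lead_coef_eq0.
by rewrite mulr0 coefB coefZ mulrBr E2; ring.
Qed.

End PolyDeriv.

(** * The degree in a fixed variable, and polynomials in a generator *)

Section Degree.
Variables (n : nat) (R : numFieldType) (a b : 'I_n -> {poly R}) (l0 : 'I_n).
Hypotheses (a0 : forall l, a l != 0) (b0 : forall l, b l != 0).
Hypothesis cop : forall l, coprimep (a l) (b l).
Hypothesis n2 : (1 < n)%N.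
Implicit Types (g G w W F : {mpoly R[n]}).

Local Notation A l := (embed l (a l)).
Local Notation B l := (embed l (b l)).
Local Notation slope := (slope a b).
Local Notation dg g := (size (asuniv l0 g)).

Lemma asuniv_slope g G l m : slope g G ->
  asuniv l (A m) * asuniv l G = asuniv l (B m) * asuniv l g^`M(m).
Proof.
move=> gG; refine (etrans (esym (asunivM l _ _)) _).
exact: etrans (congr1 (asuniv l) (gG m)) (asunivM l _ _).
Qed.

(** For another variable ['X_m], a_m and b_m are constants with respect to ['X_l0], so [G] has the
    same degree in ['X_l0] as g_m. *)
Lemma slope_size g G : slope g G -> (dg G <= dg g)%N.
Proof.
move=> gG; have [m ml] := other n2 l0; have := asuniv_slope l0 m gG.
rewrite (asuniv_embed_neq (a m) ml) (asuniv_embed_neq (b m) ml).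
have := size_asuniv_mderiv g ml.
move: (asuniv l0 G) (asuniv l0 g^`M(m)) => P Q Qg; rewrite !mul_polyC.
by move/(congr1 (fun p : {poly _} => size p)); rewrite !size_scale ?embed_eq0 // => ->.
Qed.

Lemma size_slope_coef g G : slope g G -> (1 < dg g)%N ->
  (size (b l0) <= (size (a l0)).+1)%N.
Proof.
have char0 d : (d.+1%:R : {mpoly R[n]}) != 0 by rewrite natr_poly_neq0.
move=> gG g1; rewrite -(size_asuniv_embed l0 (a l0)) -(size_asuniv_embed l0 (b l0)).
have := asuniv_slope l0 l0 gG; rewrite asuniv_deriv.
by apply: size_deriv_ratio (slope_size gG); rewrite ?asuniv_eq0 ?embed_eq0.
Qed.

Hypothesis sizeab : (size (b l0) <= (size (a l0)).+1)%N.

(** D multiplies the top coefficient of g in ['X_l0] by deg(g) times this number. The index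
    [size (a l0)] is deg a_l0 + 1, the largest degree that [sizeab] allows for b_l0, so the rate
    vanishes exactly when b_l0 has smaller degree. *)
Definition slope_rate : R := (b l0)`_(size (a l0)) / lead_coef (a l0).
Local Notation rho := slope_rate.

Lemma slope_top g G : slope g G ->
  (dg (G - ((dg g).-1%:R * rho) *: g)%R <= (dg g).-1)%N.
Proof.
have char0 d : (d.+1%:R : {mpoly R[n]}) != 0 by rewrite natr_poly_neq0.
move=> gG; have := asuniv_slope l0 l0 gG; rewrite asuniv_deriv => E.
have inj := can_inj (@mpolyCK n R).
rewrite asunivB asunivZ mpolyCM mpolyC_nat.
apply: (size_deriv_ratio_sub char0 _ _ (slope_size gG) E).
- by rewrite asuniv_eq0 embed_eq0.
- by move: sizeab; rewrite -(size_asuniv_embed l0 (a l0)) -(size_asuniv_embed l0 (b l0)).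
rewrite (size_asuniv_embed l0 (a l0)) (asuniv_embed l0 (a l0)) (asuniv_embed l0 (b l0)).
rewrite lead_coef_map_inj // coef_map /= -mpolyCM.
by rewrite divfK // lead_coef_eq0.
Qed.

Lemma slope_eq0 g G : slope g G -> (dg g <= 1)%N -> G = 0.
Proof.
move=> gG g1; have := slope_top gG; have -> : (dg g).-1 = 0%N by case: (dg g) g1 => [|[]].
by rewrite mul0r scale0r subr0 leqn0 size_poly_eq0 asuniv_eq0 => /eqP.
Qed.

Lemma slope_eigen_rate F nu : F != 0 -> slope F (nu *: F) -> nu = (dg F).-1%:R * rho.
Proof.
move=> F0 FF; have := slope_top FF; rewrite -scalerBl => le.
apply/eqP; rewrite -subr_eq0; apply: contraTT le => c0.
rewrite asunivZ size_scale ?mpolyC_eq0 //.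
by rewrite -ltnNge prednK // size_poly_gt0 asuniv_eq0.
Qed.

Lemma slope_poly w : slope w 1 -> rho = 0 ->
  forall g G, slope g G -> exists h, g = horner_alg w h.
Proof.
move=> w1 rho0 g; have [d] := ubnP (dg g); elim: d g => // d IHd g gd G gG.
have [->|g0] := eqVneq g 0; first by exists 0; rewrite rmorph0.
have [H GH] := slope_deriv a0 n2 cop gG.
have [h1 h1E] : exists h1, G = horner_alg w h1.
  apply: IHd GH; rewrite -ltnS; apply: leq_trans gd; rewrite ltnS.
  have := slope_top gG; rewrite rho0 mulr0 scale0r subr0 => le.
  by apply: leq_ltn_trans le _; rewrite prednK ?size_poly_gt0 ?asuniv_eq0.
have [h hE] := exists_antideriv h1.
(* Since D w = 1, D maps h(w) to h'(w) = h1(w), which is also D g. *)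
have := slopeB gG (slope_horner h w1); rewrite hE mulr1 h1E subrr.
move/(slope0_const b0) => [c cE]; exists (h + c%:P).
rewrite rmorphD /= horner_algC -mul_mpolyC mulr1 -cE addrC subrK //.
Qed.

Lemma asuniv_horner_alg w (h : {poly R}) :
  asuniv l0 (horner_alg w h) = map_poly (@mpolyC n R) h \Po asuniv l0 w.
Proof.
elim/poly_ind: h => [|h c IHh]; first by rewrite !rmorph0.
rewrite !rmorphD !rmorphM /= map_polyX map_polyC !horner_algX horner_algC.
rewrite comp_polyX comp_polyC IHh -mul_mpolyC mulr1.
by rewrite asunivC.
Qed.

Lemma size_asuniv_horner_alg w (h : {poly R}) :
  (dg (horner_alg w h)).-1 = ((size h).-1 * (dg w).-1)%N.
Proof.
rewrite asuniv_horner_alg size_comp_poly size_map_inj_poly //.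
exact: (can_inj (@mpolyCK n R)).
Qed.

(** F^d and w^e share the eigenvalue d e rho, hence are proportional. Both F and w are products of
    their univariate restrictions up to scalars; in each variable w_l^d divides w_l^e, which is
    proportional to F_l^d, so w_l divides F_l. *)
Lemma eigen_divides w F d e : (0 < d)%N -> (d <= e)%N -> w != 0 ->
    slope w ((d%:R * rho) *: w) -> F != 0 -> slope F ((e%:R * rho) *: F) ->
  exists q, F = w * q.
Proof.
move=> d0 de w0 ww F0 FF.
have [c cE] : exists c, F ^+ d = c *: w ^+ e.
  apply: (@slope_eigen_uniq _ _ a b b0 _ _ (d%:R * (e%:R * rho))).
  - by rewrite expf_neq0.
  - exact: slope_eigenX.
  have -> : d%:R * (e%:R * rho) = e%:R * (d%:R * rho) by ring.
  exact: slope_eigenX.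
have c0 : c != 0 by apply: contraTneq (expf_neq0 d F0) => c0; rewrite cE c0 scale0r negbK.
have [y wy] := mpoly_nonroot w0.
have Fy : F.@[y] != 0.
  have : (F ^+ d).@[y] != 0 by rewrite cE mevalZ rmorphXn mulf_neq0 ?expf_neq0.
  by rewrite rmorphXn /= expf_eq0 d0.
have [cw cwE] := slope_eigen_prod b0 wy ww.
have [cF cFE] := slope_eigen_prod b0 Fy FF.
have dvd l : restr y l w %| restr y l F.
  rewrite -(dvdp_pexp2r _ _ d0) -!rmorphXn /= cE -mul_mpolyC rmorphM /= restrC.
  rewrite mul_polyC dvdpZr // -(subnK de) exprD rmorphM /= !rmorphXn.
  exact: dvdp_mulIr.
have cw0 : cw != 0 by apply: contraNneq w0 => cw0; rewrite cwE cw0 scale0r.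
exists ((cF / cw) *: \prod_l embed l (restr y l F %/ restr y l w)).
rewrite {1}cFE {1}cwE -scalerAl -scalerAr scalerA [cw * _]mulrC divfK //.
rewrite -big_split /=; congr (_ *: _); apply: eq_bigr => l _.
by rewrite mulrC -rmorphM /= divpK.
Qed.

Lemma slope_quotient w q nu mu : w != 0 -> slope w (nu *: w) -> slope (w * q) (mu *: (w * q)) ->
  slope q ((mu - nu) *: q).
Proof.
move=> w0 ww wq l; apply: (mulfI w0); have := ww l; have := wq l.
rewrite mderivM scalerBl -!mul_mpolyC.
move: (A l) (B l) w^`M(l) q^`M(l) => al bl wl ql E1 E2.
rewrite mulrBr; transitivity (al * (mu%:MP * (w * q)) - al * (nu%:MP * w) * q); first by ring.
by rewrite E1 E2; ring.
Qed.

Lemma slope_eigen_horner w d : (0 < d)%N -> d = (dg w).-1 ->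
    slope w ((d%:R * rho) *: w) -> rho != 0 ->
    (forall g G, slope g G -> (dg g < dg w)%N -> exists c, g = c%:MP) ->
  forall g G, slope g G -> exists h, g = horner_alg w h.
Proof.
move=> d0 dE ww rho0 wmin g; have [N] := ubnP (dg g); elim: N g => // N IHN g gN G gG.
have sw : dg w = d.+1 by rewrite dE prednK //; move: d0; rewrite dE; case: (dg w).
have w0 : w != 0 by rewrite -(asuniv_eq0 l0) -size_poly_eq0 sw.
have [lt|le] := ltnP (dg g) (dg w).
  have [c ->] := wmin g G gG lt; exists c%:P.
  by rewrite horner_algC -mul_mpolyC mulr1.
have [e sg] : exists e, dg g = e.+1.
  by exists (dg g).-1; apply/esym/prednK; apply: leq_trans le; rewrite sw.
have de : (d <= e)%N by rewrite -ltnS -sw -sg.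
have [H GH] := slope_deriv a0 n2 cop gG.
have top : (dg (G - (e%:R * rho) *: g)%R <= e)%N.
  have e_pred : (dg g).-1 = e by rewrite sg.
  by have := slope_top gG; case: _ / e_pred.
have [h1 h1E] : exists h1, G - (e%:R * rho) *: g = horner_alg w h1.
  apply: IHN (slopeB GH (slopeZ _ gG)); rewrite -ltnS; apply: leq_trans gN.
  by rewrite ltnS (leq_ltn_trans top) // sg.
have lt_h1 : ((size h1).-1 * d < e)%N.
  have := size_asuniv_horner_alg w h1; rewrite -[in RHS]dE => <-.
  by move: top; rewrite h1E; move: d0 de; lia.
(* Powers of [w] are eigenvectors of D, so D h(w) - e rho h(w) = h1(w) is solved coefficient by
   coefficient. The denominators are nonzero because i d <= deg(h1) d < e. *)
pose h := \poly_(i < size h1) (h1`_i / ((i%:R * d%:R - e%:R) * rho)).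
have hE : (d%:R * rho) *: ('X * h^`()) - (e%:R * rho) *: h = h1.
  apply/polyP => i; rewrite coefB !coefZ coefXM.
  have -> : (if i == 0%N then 0 else h^`()`_i.-1) = h`_i *+ i.
    by case: i => [|i] //=; rewrite coef_deriv.
  rewrite coef_poly; case: ltnP => ih1; last by rewrite mul0rn !mulr0 subr0 nth_default.
  have ide : (i%:R * d%:R - e%:R) * rho != 0 :> R.
    rewrite mulf_neq0 // subr_eq0 -natrM eqr_nat neq_ltn; apply/orP; left.
    have : (i * d <= (size h1).-1 * d)%N.
      by rewrite leq_mul2r -ltnS prednK ?ih1 ?orbT // (leq_ltn_trans _ ih1).
    by move/leq_ltn_trans; apply.
  rewrite -[_ *+ i]mulr_natr; set x := h1`_i / _.
  transitivity (x * ((i%:R * d%:R - e%:R) * rho)); first by ring.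
  by rewrite /x divfK.
pose F := g - horner_alg w h.
have FF : slope F ((e%:R * rho) *: F).
  have := slopeB gG (slope_horner h ww).
  suff -> : G - horner_alg w h^`() * ((d%:R * rho) *: w) = (e%:R * rho) *: F by [].
  have := congr1 (horner_alg w) hE.
  rewrite rmorphB /= !horner_algZ rmorphM /= horner_algX -h1E /F scalerBr.
  rewrite -scalerAr [w * _]mulrC.
  move: (_ *: (_ * w)) (_ *: horner_alg w h) (_ *: g) => S1 S2 S3 E.
  by apply/eqP; rewrite -subr_eq0 -[G](subrK S3) -E; apply/eqP; ring.
have [F0|F0] := eqVneq F 0.
  by exists h; apply/eqP; rewrite -subr_eq0 -/F F0.
(* The eigenvalue determines the degree of [F] in ['X_l0]: it is e, so the quotient by [w] has
   degree e - d. *)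
have eF : (dg F).-1 = e.
  have /(mulIf rho0)/eqP := slope_eigen_rate F0 FF.
  by rewrite eqr_nat => /eqP/esym.
have sF : dg F = e.+1.
  by rewrite -[in RHS]eF; apply/esym/prednK; rewrite size_poly_gt0 asuniv_eq0.
have [q qE] := eigen_divides d0 de w0 ww F0 FF.
have qq : slope q ((e%:R * rho - d%:R * rho) *: q).
  by apply: slope_quotient ww _ => //; rewrite -qE.
have [h2 h2E] : exists h2, q = horner_alg w h2.
  have q0 : q != 0 by apply: contraNneq F0 => q0; rewrite qE q0 mulr0.
  have sq : e.+1 = (d.+1 + dg q).-1.
    refine (etrans (esym sF) (etrans _ (congr1 (fun k => (k + dg q).-1) sw))).
    refine (etrans (congr1 (fun x => dg x) qE) _).
    refine (etrans (congr1 (fun x : {poly _} => size x) (asunivM l0 w q)) _).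
    by apply: size_mul; rewrite asuniv_eq0.
  have eN : (e < N)%N by rewrite -ltnS -sg.
  by apply: IHN qq; lia.
exists (h + 'X * h2); rewrite rmorphD rmorphM /= horner_algX -h2E -qE /F.
by rewrite addrC subrK.
Qed.

End Degree.

(** * Choosing a minimal [w] and reading off the two forms *)

Section NormalForm.
Variables (n : nat) (R : numFieldType) (a b : 'I_n -> {poly R}) (l0 : 'I_n).
Hypotheses (a0 : forall l, a l != 0) (b0 : forall l, b l != 0).
Hypothesis cop : forall l, coprimep (a l) (b l).
Hypothesis n2 : (1 < n)%N.
Hypothesis sizeab : (size (b l0) <= (size (a l0)).+1)%N.
Implicit Types (f g G w W F : {mpoly R[n]}).

Local Notation slope := (slope a b).
Local Notation dg g := (size (asuniv l0 g)).
Local Notation rho := (slope_rate a b l0).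

Lemma exists_minimal_slope f F : slope f F -> (forall c, f <> c%:MP) ->
  exists w W, [/\ slope w W, forall c, w <> c%:MP &
    forall g G, slope g G -> (dg g < dg w)%N -> exists c, g = c%:MP].
Proof.
have [d] := ubnP (dg f); elim: d f F => // d IHd f F fd fF fnc.
have [[g [G [gG [gf gnc]]]]|nmin] := EM (exists g G, slope g G /\
  (dg g < dg f)%N /\ forall c, g <> c%:MP).
  by apply: IHd gG gnc; exact: leq_trans gf fd.
exists f, F; split=> // g G gG gf; apply: contrapT => gnc; apply: nmin.
by exists g, G; split=> //; split=> // c gc; apply: gnc; exists c.
Qed.

Lemma minimal_slope_affine w W : slope w W ->
    (forall c, w <> c%:MP) ->
    (forall g G, slope g G -> (dg g < dg w)%N -> exists c, g = c%:MP) ->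
  exists mu, W = ((dg w).-1%:R * rho) *: w + mu%:MP.
Proof.
move=> wW wnc wmin; have [H WH] := slope_deriv a0 n2 cop wW.
have w0 : w != 0 by apply/eqP => w0; apply: (wnc 0); rewrite w0 mpolyC0.
have [|mu muE] := wmin _ _ (slopeB WH (slopeZ ((dg w).-1%:R * rho) wW)); last first.
  by exists mu; rewrite -muE addrC subrK.
apply: leq_ltn_trans (slope_top a0 b0 n2 sizeab wW) _.
by rewrite prednK // size_poly_gt0 asuniv_eq0.
Qed.

(** The relation reads b_l w_l = mu a_l, so restricting w_l to any line along ['X_l] and dividing by
    [mu] yields a_l / b_l; the base point 0 is arbitrary. The antiderivatives of these restrictions
    are the summands. *)
Lemma slope_const_sum w mu : slope w mu%:MP -> mu != 0 ->
  exists p : 'I_n -> {poly R}, slope (\sum_i embed i (p i)) 1.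
Proof.
move=> ww mu0.
have /choice[p pE] : forall l : 'I_n, exists p : {poly R},
    p^`() = mu^-1 *: restr (fun=> 0) l w^`M(l) by move=> l; exact: exists_antideriv.
exists p => l; rewrite raddf_sum (bigD1 l) //= mderiv_embed eqxx.
rewrite big1 => [|j jl]; last by rewrite mderiv_embed (negPf jl).
rewrite addr0 pE -[1](rmorph1 (embed l)) -!rmorphM mulr1 -scalerAr; congr embed.
have := congr1 (restr (fun=> 0) l) (ww l).
rewrite !rmorphM /= !restr_embed restrC => <-.
by rewrite mulrC mul_polyC scalerA mulVf // scale1r.
Qed.

Lemma slope_normal_form f F : slope f F -> (forall c, f <> c%:MP) ->
  exists (h : {poly R}) (p : 'I_n -> {poly R}),
    f = horner_alg (\sum_i embed i (p i)) h \/
    f = horner_alg (\prod_i embed i (p i)) h.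
Proof.
move=> fF fnc; have [w [W [wW wnc wmin]]] := exists_minimal_slope fF fnc.
have [mu WE] := minimal_slope_affine wW wnc wmin.
have [rho0|rho_neq0] := eqVneq rho 0.
  rewrite rho0 mulr0 scale0r add0r in WE; rewrite WE in wW.
  have mu0 : mu != 0.
    apply/eqP => mu0; move: wW; rewrite mu0 mpolyC0.
    by case/(slope0_const b0) => c /wnc.
  have [p pE] := slope_const_sum wW mu0.
  have [h ->] := slope_poly a0 b0 cop n2 sizeab pE rho0 fF.
  by exists h, p; left.
have sw : (1 < dg w)%N.
  rewrite ltnNge; apply/negP => le; move: (wW).
  rewrite (slope_eq0 a0 b0 n2 sizeab wW le) => /(slope0_const b0)[c].
  exact: wnc.
have [d dE] : exists d, dg w = d.+2 by case: (dg w) sw => [|[|d]] // _; exists d.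
have {}WE : W = (d.+1%:R * rho) *: w + mu%:MP.
  by rewrite WE; congr ((_%:R * rho) *: w + _); rewrite dE.
have lam0 : d.+1%:R * rho != 0 by rewrite mulf_neq0 // pnatr_eq0.
set lam := d.+1%:R * rho in WE lam0.
(* The shift absorbs [mu], making [w1] an eigenvector for [lam]. *)
pose w1 := w + (mu / lam)%:MP.
have w1w1 : slope w1 (lam *: w1).
  have := slopeD wW (slopeC a b (mu / lam)); rewrite addr0 WE.
  by rewrite /w1 scalerDr -[lam *: (_)%:MP]mul_mpolyC -mpolyCM [lam * _]mulrC divfK.
have sw1 : dg w1 = dg w.
  rewrite /w1 rmorphD /= asunivC size_polyDl // dE.
  by apply: leq_ltn_trans (size_polyC_leq1 _) _.
have w10 : w1 != 0 by rewrite -(asuniv_eq0 l0) -size_poly_gt0 sw1 dE.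
have [y yw] := mpoly_nonroot w10.
have [c cE] := slope_eigen_prod b0 yw w1w1.
have degw1 : d.+1 = (dg w1).-1 by rewrite sw1 dE.
have w1min g G : slope g G -> (dg g < dg w1)%N -> exists c', g = c'%:MP.
  by move=> gG lt; apply: wmin gG (leq_trans lt _); exact: eq_leq sw1.
have [h hE] :=
  slope_eigen_horner a0 b0 cop n2 sizeab (ltn0Sn d) degw1 w1w1 rho_neq0 w1min fF.
(* The scalar [c] relating [w1] to the product moves into the outer polynomial. *)
exists (h \Po (c *: 'X)), (fun l => restr y l w1); right.
by rewrite horner_alg_comp horner_algZ horner_algX -cE.
Qed.

End NormalForm.

Theorem theorem1p5 (R : realType) (k : nat) (f : {mpoly R[k]})
  (hk : (3 <= k)%N)
  (hdep : forall i : 'I_k, f^`M(i) != 0)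
  (hrank : mprank f = 1%N) :
  exists (h : {poly R}) (p : 'I_k -> {poly R}),
    f = horner_alg (\sum_(i < k) horner_alg ('X_i : {mpoly R[k]}) (p i)) h \/
    f = horner_alg (\prod_(i < k) horner_alg ('X_i : {mpoly R[k]}) (p i)) h.
Proof.
have rk : (mprank f <= 1)%N by rewrite hrank.
have [a [b [cop a0 b0 cross]]] := exists_slopes hk rk hdep.
have k2 : (1 < k)%N by exact: ltnW.
have [F fF] := cross_slope a0 k2 cop cross.
pose l0 := Ordinal k2.
(* As [f] involves ['X_l0], its own slope relation yields the degree bound between b_l0 and a_l0. *)
have f1 : (1 < size (asuniv l0 f))%N.
  rewrite ltnNge; apply: contra (hdep l0) => f1.
  by rewrite -(asuniv_eq0 l0) asuniv_deriv (size1_polyC f1) derivC.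
apply: (slope_normal_form a0 b0 cop k2 (size_slope_coef a0 b0 k2 fF f1) fF).
by move=> c fc; move: (hdep l0); rewrite fc mderivC eqxx.
Qed.
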